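(* Let $\mathcal X\in\mathbb R^{n_1\times n_2\times n_3}$, let $r$ be a target rank with $r\le \min(n_1,n_2)$, and for $\ell=1,\dots,n_3$ let $V^{(\ell)}\in\mathbb C^{n_2\times r}$ have orthonormal columns, with $V^{(n_3-\ell+2)}=\overline{V^{(\ell)}}$ for $2\le \ell\le n_3$ and $V^{(1)}$ real (so also $V^{(n_3/2+1)}$ is real when $n_3$ is even). Let $\mathcal X_{\mathrm{TCUR}}$ be the random tensor produced by the Fourier-slicewise ARP-T-CUR algorithm (described in the context) applied to $\mathcal X$, $r$ and the bases $V^{(\ell)}$. Assume that, for every nonredundant frequency $\ell=1,\dots,\lfloor n_3/2\rfloor+1$ (with $\ell\le n_3$), the selected column matrix $\widehat X^{(\ell)}(:,J_\ell)$ has rank $r$ and the intersection $\widehat X^{(\ell)}(I_\ell,J_\ell)$ is nonsingular almost surely. Then $$\mathbb E\|\mathcal X-\mathcal X_{\mathrm{TCUR}}\|_F^2\le \frac{(r+1)^2}{n_3}\sum_{\ell=1}^{n_3}\bigl\|\widehat X^{(\ell)}-\widehat X^{(\ell)}V^{(\ell)}(V^{(\ell)})^H\bigr\|_F^2 .$$ If moreover $V^{(\ell)}$ contains the leading $r$ right singular vectors of $\widehat X^{(\ell)}$ for every frequency $\ell$, then $$\mathbb E\|\mathcal X-\mathcal X_{\mathrm{TCUR}}\|_F^2\le (r+1)^2\|\mathcal X-\mathcal X_r\|_F^2 ,$$ where $\mathcal X_r$ is the truncated T-SVD of $\mathcal X$ of tubal rank $r$.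
   Context: Conventions. $\widehat{\mathcal X}$ is the unnormalized discrete Fourier transform of $\mathcal X$ along the third mode, with frontal slices $\widehat X^{(\ell)}=\sum_{k=1}^{n_3}e^{-2\pi i(\ell-1)(k-1)/n_3}X^{(k)}$, where $X^{(k)}=\mathcal X(:,:,k)$; ifft is its inverse. $\|\cdot\|_F$ is the Frobenius norm and $^H$ the conjugate transpose. Truncated T-SVD: $\mathcal X_r$ is the tensor whose Fourier slices are the rank-$r$ truncated singular value decompositions of the $\widehat X^{(\ell)}$. It is a best approximation of $\mathcal X$ in Frobenius norm among tensors whose tubal rank ($\max_\ell \operatorname{rank}$ of the Fourier slices) is at most $r$. Matrix ARP. Input: $V\in\mathbb C^{n\times r}$ with orthonormal columns. Set $W_0=V$. For $k=1,\dots,r$: conditionally on the past, sample $j_k\in\{1,\dots,n\}$ with probabilities $p_j=\|W_{k-1}(j,k:r)\|_2^2/(r-k+1)$; then set $W_k=W_{k-1}Q_k$, where $Q_k$ is a unitary Householder reflector acting only on columns $k,\dots,r$ (identity on the first $k-1$ coordinates) such that the entries of $W_{k-1}Q_k$ in row $j_k$ and columns $k+1,\dots,r$ vanish. Output: $J=(j_1,\dots,j_r)$. Matrix ARP-cross. Input: a matrix $X\in\mathbb C^{n_1\times n_2}$ and $V\in\mathbb C^{n_2\times r}$ with orthonormal columns. Apply ARP to $V$ to get column indices $J$; compute an orthonormal basis $Q_J$ of the range of $X(:,J)$ by a QR decomposition; apply ARP (with fresh randomness) to $Q_J$ to get row indices $I$. Output: $(I,J)$. Fourier-slicewise ARP-T-CUR.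 Compute $\widehat{\mathcal X}$. For each nonredundant frequency $\ell=1,\dots,\lfloor n_3/2\rfloor+1$ (with $\ell\le n_3$), apply matrix ARP-cross to $(\widehat X^{(\ell)},V^{(\ell)})$ to get $I_\ell,J_\ell$, each of cardinality $r$, and set $$\widehat X_{\mathrm{TCUR}}^{(\ell)}=\widehat X^{(\ell)}(:,J_\ell)\bigl(\widehat X^{(\ell)}(I_\ell,J_\ell)\bigr)^{-1}\widehat X^{(\ell)}(I_\ell,:).$$ For the paired frequency $\ell'=n_3-\ell+2$, if $\ell'\ne\ell$ and $2\le \ell'\le n_3$, set $\widehat X_{\mathrm{TCUR}}^{(\ell')}=\overline{\widehat X_{\mathrm{TCUR}}^{(\ell)}}$ (so the same random choices are used for conjugate pairs). At the self-conjugate frequencies ($\ell=1$, and $\ell=n_3/2+1$ if $n_3$ is even) the basis and the slicewise approximation are chosen real. Output $\mathcal X_{\mathrm{TCUR}}=\operatorname{real}(\mathrm{ifft}(\widehat{\mathcal X}_{\mathrm{TCUR}}))$ along the third mode. The expectation is over all random index choices. *)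

(* Defs.v *)
From mathcomp Require Import all_boot all_order all_algebra.
From mathcomp Require Import reals trigo complex.

Set Implicit Arguments.
Unset Strict Implicit.
Unset Printing Implicit Defensive.

Import Order.TTheory GRing.Theory Num.Theory.
Local Open Scope ring_scope.
Local Open Scope sesquilinear_scope.

(* All indices (frequencies, slices, ARP steps, rows, columns) start at 0, so
   l, k, ... below stand for l-1, k-1, ... in the usual 1-based notation.
   A third-order tensor of size n1 x n2 x n3 is the family of its frontal
   slices. *)
Notation tensor K n1 n2 n3 := ('I_n3 -> 'M[K]_(n1, n2)).

Section FiniteProbability.
Variables (R : realType) (T : finType).

Definition Pr (law : T -> R) (E : T -> bool) : R := \sum_(w | E w) law w.

Definition Expect (law : T -> R) (f : T -> R) : R := \sum_w law w * f w.

End FiniteProbability.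

Section ComplexMatrices.
Variable R : realType.
Local Notation C := R[i].

Definition cmod (z : C) : R := complex.Re `|z|.

Definition frob m n (A : 'M[C]_(m, n)) : R :=
  Num.sqrt (\sum_i \sum_j cmod (A i j) ^+ 2).

Definition tfrob n1 n2 n3 (A : tensor C n1 n2 n3) : R :=
  Num.sqrt (\sum_k frob (A k) ^+ 2).

Definition cplx_mx m n (A : 'M[R]_(m, n)) : 'M[C]_(m, n) :=
  map_mx (real_complex R) A.

Definition orthonormal_cols m n (V : 'M[C]_(m, n)) : Prop :=
  V^t* *m V = 1%:M.

(* Only the values s i with i < minn m n matter. *)
Definition diag_sv m n (s : nat -> R) : 'M[C]_(m, n) :=
  \matrix_(i, j) (if i == j :> nat then s i else 0)%:C%C.

Definition is_svd m n (A : 'M[C]_(m, n))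
    (U : 'M[C]_m) (s : nat -> R) (W : 'M[C]_n) : Prop :=
  [/\ U \is unitarymx, W \is unitarymx,
      forall i, 0 <= s i,
      forall i j, (i <= j)%N -> s j <= s i
    & A = U *m diag_sv m n s *m W^t*].

Definition is_truncated_svd r m n (A B : 'M[C]_(m, n)) : Prop :=
  exists U s W, is_svd A U s W /\
    B = U *m diag_sv m n (fun i => if (i < r)%N then s i else 0) *m W^t*.

Definition contains_leading_rsv r m n (A : 'M[C]_(m, n)) (V : 'M[C]_(n, r))
    : Prop :=
  exists U s W, is_svd A U s W /\
    forall i : 'I_n, (i < r)%N -> exists j : 'I_r, col j V = col i W.

Definition is_qr m n (A Q : 'M[C]_(m, n)) : Prop :=
  orthonormal_cols Q /\
  exists T : 'M[C]_n, (forall i j : 'I_n, (j < i)%N -> T i j = 0) /\ A = Q *m T.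

End ComplexMatrices.

Section FourierThirdMode.
Variables (R : realType) (n1 n2 n3 : nat).
Local Notation C := R[i].

Definition cis (t : R) : C := (cos t +i* sin t)%C.

Definition dft (A : tensor C n1 n2 n3) : tensor C n1 n2 n3 := fun l =>
  \sum_(k < n3) cis (- (2 * pi * (l * k)%:R / n3%:R)) *: A k.

Definition ifft (A : tensor C n1 n2 n3) : tensor C n1 n2 n3 := fun k =>
  n3%:R^-1 *: \sum_(l < n3) cis (2 * pi * (l * k)%:R / n3%:R) *: A l.

(* Xr may be complex: with tied singular values the slices of X need not be
   truncated in a conjugate-symmetric way. *)
Definition is_truncated_tsvd r (X Xr : tensor C n1 n2 n3) : Prop :=
  forall l, is_truncated_svd r (dft X l) (dft Xr l).

Definition fhat (X : tensor R n1 n2 n3) : tensor C n1 n2 n3 :=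
  dft (fun k => cplx_mx (X k)).

End FourierThirdMode.

(* The frequency paired with l: n - l for 0 < l, and 0 for l = 0. *)
Fact conj_freq_subproof n (l : 'I_n) : ((n - l) %% n < n)%N.
Proof. by rewrite ltn_mod (leq_ltn_trans _ (ltn_ord l)). Qed.

Definition conj_freq n (l : 'I_n) : 'I_n := Ordinal (conj_freq_subproof l).

Definition nonred n := {l : 'I_n | (l <= n./2)%N}.

Section ARP.
Variables (R : realType) (n r : nat).
Local Notation C := R[i].

(* A run of ARP is determined by the sampled indices once the Householder
   reflectors are fixed.  The reflector is not unique (phase, normalization,
   arbitrary choice on a zero row), so ARP is parameterized by a function H that
   returns the reflector used after a given history of samples: after sampling
   j_0, ..., j_k it is H [:: j_0; ...; j_k]. *)
Fixpoint arp_W (V : 'M[C]_(n, r)) (H : seq 'I_n -> 'M[C]_r) (s : seq 'I_n)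
    (k : nat) : 'M[C]_(n, r) :=
  if k is k'.+1 then arp_W V H s k' *m H (take k s) else V.

(* Elementary reflector 1 - tau v v^H, required to be unitary; this covers
   tau = 2 / |v|^2 as well as the complex tau of the usual numerical codes. *)
Definition householder_from (k : nat) (Q : 'M[C]_r) : Prop :=
  Q \is unitarymx /\
  exists (tau : C) (v : 'cV[C]_r),
    (forall i : 'I_r, (i < k)%N -> v i 0 = 0) /\
    Q = 1%:M - tau *: (v *m v^t*).

Definition arp_reflectors (V : 'M[C]_(n, r)) (H : seq 'I_n -> 'M[C]_r) : Prop :=
  forall (J : r.-tuple 'I_n) (k : 'I_r),
    householder_from k (H (take k.+1 J)) /\
    forall i : 'I_r, (k < i)%N -> arp_W V H J k.+1 (tnth J k) i = 0.

Definition arp_prob (W : 'M[C]_(n, r)) (k : nat) (j : 'I_n) : R :=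
  (\sum_(i < r | (k <= i)%N) cmod (W j i) ^+ 2) / (r - k)%:R.

(* Chain rule: product of the conditional sampling probabilities. *)
Definition arp_law (V : 'M[C]_(n, r)) (H : seq 'I_n -> 'M[C]_r)
    (J : r.-tuple 'I_n) : R :=
  \prod_(k < r) arp_prob (arp_W V H J k) k (tnth J k).

End ARP.

Section ARPCross.
Variables (R : realType) (n1 n2 r : nat).
Local Notation C := R[i].

(* The deterministic choices left open by matrix ARP-cross. *)
Record cross_choices := CrossChoices {
  col_refl : seq 'I_n2 -> 'M[C]_r;
  qr_basis : r.-tuple 'I_n2 -> 'M[C]_(n1, r);
  row_refl : r.-tuple 'I_n2 -> seq 'I_n1 -> 'M[C]_r }.

Definition valid_choices (X : 'M[C]_(n1, n2)) (V : 'M[C]_(n2, r))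
    (c : cross_choices) : Prop :=
  arp_reflectors V (col_refl c) /\
  forall J, is_qr (colsub (tnth J) X) (qr_basis c J) /\
            arp_reflectors (qr_basis c J) (row_refl c J).

(* Outcomes are the pairs (I, J) of selected row and column indices. *)
Definition cross_outcome := (r.-tuple 'I_n1 * r.-tuple 'I_n2)%type.

Definition cross_law (V : 'M[C]_(n2, r)) (c : cross_choices)
    (w : cross_outcome) : R :=
  arp_law V (col_refl c) w.2 *
  arp_law (qr_basis c w.2) (row_refl c w.2) w.1.

Definition intersection (X : 'M[C]_(n1, n2)) (w : cross_outcome) : 'M[C]_r :=
  mxsub (tnth w.1) (tnth w.2) X.

Definition cur (X : 'M[C]_(n1, n2)) (w : cross_outcome) : 'M[C]_(n1, n2) :=
  colsub (tnth w.2) X *m invmx (intersection X w) *m rowsub (tnth w.1) X.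

End ARPCross.

Section ARPTCUR.
Variables (R : realType) (n1 n2 n3 r : nat).
Local Notation C := R[i].

Definition tcur_outcome := {ffun nonred n3 -> cross_outcome n1 n2 r}.

(* The frequencies are sampled independently. *)
Definition tcur_law (V : 'I_n3 -> 'M[C]_(n2, r))
    (c : nonred n3 -> cross_choices R n1 n2 r) (w : tcur_outcome) : R :=
  \prod_(l : nonred n3) cross_law (V (val l)) (c l) (w l).

(* If l > n3 / 2 then conj_freq l is nonredundant: the last case never occurs. *)
Definition tcur_hat (X : tensor R n1 n2 n3) (w : tcur_outcome)
    : tensor C n1 n2 n3 := fun l =>
  let A (m : nonred n3) := cur (fhat X (val m)) (w m) in
  if insub l is Some m then A m
  else if insub (conj_freq l) is Some m then (A m) ^ Num.conj
  else 0.

Definition tcur (X : tensor R n1 n2 n3) (w : tcur_outcome)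
    : tensor R n1 n2 n3 := fun k =>
  map_mx (@complex.Re R) (ifft (tcur_hat X w) k).

Definition tcur_mse (X : tensor R n1 n2 n3) (V : 'I_n3 -> 'M[C]_(n2, r))
    (c : nonred n3 -> cross_choices R n1 n2 r) : R :=
  Expect (tcur_law V c)
    (fun w => tfrob (fun k => cplx_mx (X k - tcur X w k)) ^+ 2).

End ARPTCUR.

(* Main.v *)
(* Whatever the reflectors, the rows selected from the final basis [V Q] of ARP
   form a lower triangular matrix, and the sampling probabilities are its squared
   diagonal entries up to the factors [r - k]: [J] is drawn with probability
   [|det V_J|^2 / r!].  For [E V = 0], Cramer's rule and the Cauchy-Binet formula,
   summed over ordered tuples, bound the sum over [J] with [V_J] nonsingular of
   [|det V_J|^2 |E_J V_J^{-H}|_F^2] by [r! r |E|_F^2].  With [E = X - X V V^H], the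
   oblique projection error [X - X_J V_J^{-H} V^H = E - E_J V_J^{-H} V^H] has
   therefore mean square at most [(r + 1) |E|_F^2].  The CUR approximation equals
   [Q_J Q_I^{-1} X_I], so the same estimate applies to the rows of [X] and the
   basis [Q_J] of the range of [X_J]; the orthogonal projection onto this range is
   at least as good as the oblique one, which gives the factor [(r + 1)^2].
   Parseval's identity and conjugate symmetry pass from slices to tensors, and Ky
   Fan's inequality compares [V] with the truncated decompositions. *)

Require Import Defs.
From mathcomp Require Import all_boot all_order all_algebra perm.
From mathcomp Require Import reals trigo complex lra.

Set Implicit Arguments.
Unset Strict Implicit.
Unset Printing Implicit Defensive.

Import Order.TTheory GRing.Theory Num.Theory.
Local Open Scope ring_scope.
Local Open Scope sesquilinear_scope.

(** * The Cauchy-Binet formula over ordered tuples *)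

Lemma sum_tuple_ffun (R : nmodType) (r : nat) (T : finType)
    (F : r.-tuple T -> R) :
  \sum_(J : r.-tuple T) F J = \sum_(f : {ffun 'I_r -> T}) F [tuple f i | i < r].
Proof.
apply: (reindex (fun f : {ffun 'I_r -> T} => [tuple f i | i < r])).
exists (fun J : r.-tuple T => [ffun i => tnth J i]) => [f _|J _].
  by apply/ffunP => i; rewrite ffunE tnth_mktuple.
by apply: eq_from_tnth => i; rewrite tnth_mktuple ffunE.
Qed.

(** After expanding both determinants over permutations, the sum over [J] factors into a product of
    entries of [A^T *m B]. Each permutation of the first expansion then contributes one copy of
    [\det (A^T *m B)], whence the factorial. *)
Lemma Cauchy_Binet_tuple (R : comNzRingType) (n r : nat) (A B : 'M[R]_(n, r)) :
  \sum_(J : r.-tuple 'I_n)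
     \det (rowsub (tnth J) A) * \det (rowsub (tnth J) B) =
  r`!%:R * \det (A^T *m B).
Proof.
transitivity (\sum_(s : 'S_r) \det (A^T *m B)); last first.
  by rewrite sumr_const card_Sn mulr_natl.
under eq_bigr => J _ do rewrite {1}/determinant big_distrl.
rewrite exchange_big /=; apply: eq_bigr => s _.
transitivity ((-1) ^+ s * \det (row_perm s (A^T *m B))); last first.
  by rewrite row_permE det_mulmx det_perm mulrA -expr2 sqrr_sign mul1r.
rewrite /determinant mulr_sumr sum_tuple_ffun.
under eq_bigr => f _ do rewrite mulr_sumr.
rewrite exchange_big /=; apply: eq_bigr => t _.
under eq_bigr => f _ do rewrite mulrACA -mulrA -big_split /=.
rewrite -!mulr_sumr; congr (_ * _); congr (_ * _).
under [RHS]eq_bigr => i _ do rewrite !mxE.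
rewrite bigA_distr_bigA /=; apply: eq_bigr => f _.
by apply: eq_bigr => i _; rewrite !mxE !tnth_mktuple.
Qed.

(** * The squared Frobenius norm *)

Section Frobenius.
Variable C : numClosedFieldType.

(** The squared Frobenius norm, written as a trace with values in [C]: unitary invariance and
    Pythagoras become matrix identities without square roots. *)
Definition sqnorm m n (A : 'M[C]_(m, n)) : C := \tr (A *m A^t*).

Lemma trCmx_mul m n p (A : 'M[C]_(m, n)) (B : 'M[C]_(n, p)) :
  (A *m B)^t* = B^t* *m A^t*.
Proof. by rewrite trmx_mul map_mxM. Qed.

Lemma trC_rowsub p m q (f : 'I_q -> 'I_m) (A : 'M[C]_(m, p)) :
  (rowsub f A)^t* = colsub f (A^t*).
Proof. by apply/matrixP => i j; rewrite !mxE. Qed.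

Lemma sqnormE m n (A : 'M[C]_(m, n)) :
  sqnorm A = \sum_i \sum_j `|A i j| ^+ 2.
Proof.
apply: eq_bigr => i _; rewrite mxE; apply: eq_bigr => j _.
by rewrite !mxE normCK.
Qed.

Lemma sqnorm_ge0 m n (A : 'M[C]_(m, n)) : 0 <= sqnorm A.
Proof.
by rewrite sqnormE; do 2![apply: sumr_ge0 => ? _]; rewrite exprn_ge0.
Qed.

Lemma sqnorm_trC m n (A : 'M[C]_(m, n)) : sqnorm (A^t*) = sqnorm A.
Proof. by rewrite /sqnorm trmxCK mxtrace_mulC. Qed.

Lemma sqnorm_mulr m n p (A : 'M[C]_(m, n)) (V : 'M[C]_(p, n)) :
  V^t* *m V = 1%:M -> sqnorm (A *m V^t*) = sqnorm A.
Proof.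
by move=> V1; rewrite /sqnorm trCmx_mul trmxCK mulmxA -(mulmxA A) V1 mulmx1.
Qed.

(** Pythagoras: the rows of [A] are orthogonal to those of [B], so the cross terms vanish. *)
Lemma sqnormD m n (A B : 'M[C]_(m, n)) :
  A *m B^t* = 0 -> sqnorm (A + B) = sqnorm A + sqnorm B.
Proof.
move=> AB0; have BA0 : B *m A^t* = 0.
  by rewrite -[B]trmxCK -trCmx_mul AB0 trmx0 map_mx0.
rewrite /sqnorm linearD map_mxD mulmxDl !mulmxDr /= AB0 BA0 addr0 add0r.
by rewrite mxtraceD.
Qed.

Lemma sqnormN m n (A : 'M[C]_(m, n)) : sqnorm (- A) = sqnorm A.
Proof. by rewrite /sqnorm linearN map_mxN mulmxN mulNmx opprK. Qed.

Lemma sqnormB m n (A B : 'M[C]_(m, n)) :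
  A *m B^t* = 0 -> sqnorm (A - B) = sqnorm A + sqnorm B.
Proof.
move=> AB0; rewrite sqnormD ?sqnormN //.
by rewrite linearN map_mxN mulmxN AB0 oppr0.
Qed.

Lemma sqnormZ m n a (A : 'M[C]_(m, n)) : sqnorm (a *: A) = `|a| ^+ 2 * sqnorm A.
Proof.
rewrite !sqnormE mulr_sumr; apply: eq_bigr => i _.
by rewrite mulr_sumr; apply: eq_bigr => j _; rewrite mxE normrM exprMn.
Qed.

End Frobenius.

(** * Volume sampling and the oblique projection error *)

Section VolumeSampling.
Variables (C : numClosedFieldType) (n r : nat) (V : 'M[C]_(n, r)).
Hypothesis V1 : V^t* *m V = 1%:M.

Definition volume_prob (J : r.-tuple 'I_n) : C :=
  `|\det (rowsub (tnth J) V)| ^+ 2 / r`!%:R.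

(** For nonsingular [V_J], the matrix with rows in the row space of [V^t*] that agrees with [A] on
    the columns [J]. For singular [V_J], [invmx] takes a default value, but then [volume_prob J] is
    0. *)
Definition oblique_proj m (A : 'M[C]_(m, n)) (J : r.-tuple 'I_n) :
    'M[C]_(m, n) :=
  colsub (tnth J) A *m invmx ((rowsub (tnth J) V)^t*) *m V^t*.

Lemma sum_sqr_det_rowsub (B : 'M[C]_(n, r)) :
  \sum_(J : r.-tuple 'I_n) `|\det (rowsub (tnth J) B)| ^+ 2 =
  r`!%:R * \det (B^t* *m B).
Proof.
rewrite -map_trmx -Cauchy_Binet_tuple; apply: eq_bigr => J _.
rewrite normCK mulrC -det_map_mx; congr (\det _ * _).
by apply/matrixP => i j; rewrite !mxE.
Qed.

Lemma sum_volume_prob : \sum_J volume_prob J = 1.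
Proof.
rewrite -mulr_suml sum_sqr_det_rowsub V1 det1 mulr1 divff //.
by rewrite pnatr_eq0 -lt0n fact_gt0.
Qed.

(** The matrix whose minors are the numerators in Cramer's rule; conjugation turns the row [v] into
    the column [v^H]. *)
Definition repl_col (v : 'rV[C]_n) (k : 'I_r) : 'M[C]_(n, r) :=
  \matrix_(j, c) if c == k then (v 0 j)^* else V j c.

(** The new column is orthogonal to the remaining columns of [V], so the Gram matrix is diagonal
    with entry [sqnorm v] at [k] and 1 elsewhere. *)
Lemma gram_repl_col (v : 'rV[C]_n) k : v *m V = 0 ->
  \det ((repl_col v k)^t* *m repl_col v k) = sqnorm v.
Proof.
move=> vV.
have -> : (repl_col v k)^t* *m repl_col v k =
    diag_mx (\row_c if c == k then sqnorm v else 1).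
  apply/matrixP => a b; rewrite !mxE.
  have vV0 c : \sum_j v 0 j * V j c = 0.
    by have := congr1 (fun M : 'rV_r => M 0 c) vV; rewrite !mxE.
  have V1E c d : \sum_j (V j c)^* * V j d = (c == d)%:R.
    have := congr1 (fun M : 'M_r => M c d) V1; rewrite !mxE => <-.
    by apply: eq_bigr => j _; rewrite !mxE.
  under eq_bigr => j _ do rewrite !mxE.
  case: (eqVneq a k) => [->|ak]; case: (eqVneq b k) => [bk|bk]; rewrite ?bk.
  - rewrite sqnormE big_ord1 mulr1n; apply: eq_bigr => j _.
    by rewrite conjCK normCK.
  - rewrite mulr0n -[RHS](vV0 b); apply: eq_bigr => j _.
    by rewrite conjCK.
  - rewrite (negPf ak) mulr0n -[RHS](conjC0 C) -[in RHS](vV0 a) rmorph_sum.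
    by apply: eq_bigr => j _; rewrite rmorphM mulrC.
  - by rewrite V1E.
rewrite det_diag (bigD1 k) //= big1 ?mulr1 ?mxE ?eqxx // => i ik.
by rewrite mxE (negPf ik).
Qed.

(* Cramer's rule: an entry of [E_J adj(V_J^H)] is, up to conjugation, the
   determinant of [V_J] with one column replaced by a row of [E^H]. *)
Lemma mul_adj_entry m (E : 'M[C]_(m, n)) (J : r.-tuple 'I_n) i k :
  (colsub (tnth J) E *m \adj ((rowsub (tnth J) V)^t*)) i k =
  (\det (rowsub (tnth J) (repl_col (row i E) k)))^*.
Proof.
rewrite -det_map_mx -det_tr map_trmx (expand_det_row _ k) mxE.
apply: eq_bigr => t _; rewrite !mxE ?eqxx.
rewrite -[Num.Num_conj__canonical__GRing_RMorphism C _]/(_^*) conjCK.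
congr (_ * (_ * \det _)).
apply/matrixP => a b; rewrite !mxE.
by rewrite eq_sym (negPf (neq_lift _ _)).
Qed.

(** By Cramer's rule and Cauchy-Binet, each row of [E] and each position [k] contribute the
    factorial times the squared norm of the row; the [r] positions give the factor [r]. *)
Lemma sum_sqnorm_mul_adj m (E : 'M[C]_(m, n)) : E *m V = 0 ->
  \sum_(J : r.-tuple 'I_n)
    sqnorm (colsub (tnth J) E *m \adj ((rowsub (tnth J) V)^t*)) =
  r`!%:R * (r%:R * sqnorm E).
Proof.
move=> EV.
under eq_bigr => J _ do rewrite sqnormE.
under eq_bigr => J _.
  under eq_bigr => i _ do under eq_bigr => k _ do
    rewrite mul_adj_entry norm_conjC.
  over.
rewrite exchange_big /=.
transitivity (\sum_(i < m) r`!%:R * (r%:R * sqnorm (row i E))); last first.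
  rewrite -!mulr_sumr; congr (_ * (_ * _)); rewrite [RHS]sqnormE.
  apply: eq_bigr => i _; rewrite sqnormE big_ord1.
  by apply: eq_bigr => j _; rewrite mxE.
apply: eq_bigr => i _; rewrite exchange_big /=.
under eq_bigr => k _ do
  rewrite sum_sqr_det_rowsub gram_repl_col -?row_mul ?EV ?row0 //.
by rewrite sumr_const card_ord -[LHS]mulr_natl mulrCA.
Qed.

(* Equality holds when every minor [V_J] is nonsingular; a singular one has
   probability 0 on the left but may contribute on the right. *)
Lemma volume_sampling_cols m (A : 'M[C]_(m, n)) :
  \sum_J volume_prob J * sqnorm (A - oblique_proj A J) <=
  r.+1%:R * sqnorm (A - A *m V *m V^t*).
Proof.
set E := A - A *m V *m V^t*.
have EV : E *m V = 0 by rewrite mulmxBl -!mulmxA V1 mulmx1 subrr.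
have f0 : r`!%:R != 0 :> C by rewrite pnatr_eq0 -lt0n fact_gt0.
(* The constant splits as [1 + r]: total probability 1 times the residual, plus the adjugate sum.
   The bound can then be proved for each [J] separately. *)
have -> : r.+1%:R * sqnorm E = \sum_J (volume_prob J * sqnorm E +
   sqnorm (colsub (tnth J) E *m \adj ((rowsub (tnth J) V)^t*)) / r`!%:R).
  rewrite big_split /= -mulr_suml sum_volume_prob.
  rewrite -mulr_suml sum_sqnorm_mul_adj //.
  by rewrite mulrAC divff // !mul1r -natr1 mulrDl mul1r addrC.
apply: ler_sum => J _; rewrite /volume_prob.
set VJ := rowsub (tnth J) V.
have [d0|d0] := eqVneq (\det VJ) 0.
  rewrite d0 normr0 expr0n !mul0r add0r divr_ge0 ?sqnorm_ge0 //.
have VJu : VJ^t* \in unitmx.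
  by rewrite unitmxE det_map_mx det_tr unitfE fmorph_eq0.
(* The oblique projection fixes [A V V^H], so only the residual [E] matters. *)
have -> : A - oblique_proj A J = E - oblique_proj E J.
  rewrite {1}/E -addrA; congr (_ + _); rewrite -opprD; congr (- _).
  have AVJ : colsub (tnth J) (A *m V *m V^t*) = A *m V *m VJ^t*.
    rewrite trC_rowsub; apply/matrixP => i j; rewrite !mxE.
    by apply: eq_bigr => k _; rewrite !mxE.
  rewrite /oblique_proj /E raddfB /= !mulmxBl AVJ mulmxK //.
  by rewrite addrCA subrr addr0.
rewrite sqnormB; last first.
  by rewrite trCmx_mul trmxCK mulmxA EV mul0mx.
rewrite mulrDr sqnorm_mulr // lerD2l.
(* The inverse is the adjugate over the determinant, whose squared modulus cancels the weight. *)
rewrite /invmx VJu -scalemxAr sqnormZ normfV exprVn det_map_mx det_tr.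
rewrite norm_conjC mulrAC mulrA mulfV ?mul1r //.
by rewrite expf_eq0 /= normr_eq0.
Qed.

End VolumeSampling.

(** * The law of ARP is volume sampling *)

Lemma entry_eq_row (T : Type) m n (A B : 'M[T]_(m, n)) i j :
  row i A = row i B -> A i j = B i j.
Proof. by move/rowP/(_ j); rewrite !mxE. Qed.

Section ARPLaw.
Variables (R : realType) (n r : nat).
Local Notation C := R[i].

Lemma cmodC (z : C) : (cmod z)%:C%C = `|z|.
Proof. by rewrite RRe_real ?normr_real. Qed.

Lemma cmod_sqrC (z : C) : (cmod z ^+ 2)%:C%C = `|z| ^+ 2.
Proof. by rewrite rmorphXn /= cmodC. Qed.

Lemma householder_mulE k (Q : 'M[C]_r) (W : 'M[C]_(n, r)) (j : 'I_n)
    (i : 'I_r) :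
  householder_from k Q -> (i < k)%N -> (W *m Q) j i = W j i.
Proof.
case=> _ [tau [v [v0 ->]]] ik.
rewrite mulmxBr mulmx1 -scalemxAr mulmxA !mxE [X in _ * X]big1 ?mulr0 ?subr0 //.
by move=> a _; rewrite (ord1 a) !mxE v0 // conjC0 mulr0.
Qed.

(** The vector [v] is supported on coordinates from [k] on, so the product of such a row with [v] is
    zero. *)
Lemma householder_mul_row0 k (Q : 'M[C]_r) (W : 'M[C]_(n, r)) (j : 'I_n) :
  householder_from k Q -> (forall i : 'I_r, (k <= i)%N -> W j i = 0) ->
  row j (W *m Q) = row j W.
Proof.
case=> _ [tau [v [v0 ->]]] W0; apply/rowP => i.
rewrite mulmxBr mulmx1 -scalemxAr mulmxA !mxE [X in _ * X]big1 ?mulr0 ?subr0 //.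
move=> a _; rewrite (ord1 a) !mxE big1 ?mul0r // => b _.
by have [bk|kb] := ltnP b k; [rewrite v0 ?mulr0 | rewrite W0 ?mul0r].
Qed.

(** A unitary matrix keeps the norm of the whole row, and this one also fixes the first [k]
    entries. *)
Lemma householder_tail_norm k (Q : 'M[C]_r) (W : 'M[C]_(n, r)) (j : 'I_n) :
  householder_from k Q ->
  \sum_(i < r | (k <= i)%N) `|(W *m Q) j i| ^+ 2 =
  \sum_(i < r | (k <= i)%N) `|W j i| ^+ 2.
Proof.
move=> hQ; have [/unitarymxP Q1 _] := hQ.
have : sqnorm (row j (W *m Q)) = sqnorm (row j W).
  by rewrite /sqnorm row_mul trCmx_mul mulmxA -(mulmxA _ Q) Q1 mulmx1.
rewrite !sqnormE !big_ord1.
rewrite (bigID (fun i : 'I_r => (k <= i)%N)) /=.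
rewrite [RHS](bigID (fun i : 'I_r => (k <= i)%N)) /=.
have -> : \sum_(i < r | ~~ (k <= i)%N) `|row j (W *m Q) 0 i| ^+ 2 =
          \sum_(i < r | ~~ (k <= i)%N) `|row j W 0 i| ^+ 2.
  apply: eq_bigr => i; rewrite -ltnNge => ik.
  by rewrite mxE (householder_mulE _ _ hQ) // mxE.
move/addIr; under eq_bigr => i _ do rewrite mxE.
by move=> ->; apply: eq_bigr => i _; rewrite mxE.
Qed.

Variables (V : 'M[C]_(n, r)) (H : seq 'I_n -> 'M[C]_r).
Hypothesis HV : arp_reflectors V H.

Lemma arp_W_unitary (J : r.-tuple 'I_n) k : (k <= r)%N ->
  exists2 Q : 'M[C]_r, Q \is unitarymx & arp_W V H J k = V *m Q.
Proof.
elim: k => [_|k IHk kr].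
  exists 1%:M; last by rewrite mulmx1.
  by apply/unitarymxP; rewrite trmx1 map_mx1 mulmx1.
have [Q Q1 /= ->] := IHk (ltnW kr).
have [[hQ _] _] := HV J (Ordinal kr).
exists (Q *m H (take k.+1 J)); last by rewrite mulmxA.
exact: (mul_unitarymx Q1 hQ).
Qed.

(** After step [k] the selected row is zero beyond column [k], where all later reflectors act. *)
Lemma arp_W_row_fixed (J : r.-tuple 'I_n) (k : 'I_r) m :
  (k < m <= r)%N ->
  row (tnth J k) (arp_W V H J m) = row (tnth J k) (arp_W V H J k.+1).
Proof.
elim: m => // m IHm /andP[]; rewrite ltnS leq_eqVlt => /orP[/eqP->//|km mr].
have [hQ _] := HV J (Ordinal mr).
have {}IHm := IHm _; rewrite km ltnW // in IHm; rewrite -IHm //.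
apply: (householder_mul_row0 hQ) => i /= mi.
rewrite (entry_eq_row _ (IHm isT)).
by apply: (proj2 (HV J k)); apply: leq_trans km mi.
Qed.

Lemma arp_lawE (J : r.-tuple 'I_n) : (arp_law V H J)%:C%C = volume_prob V J.
Proof.
have [Q /unitarymxP Q1 WQ] := arp_W_unitary J (leqnn r).
have Wrow (k i : 'I_r) :
    arp_W V H J r (tnth J k) i = arp_W V H J k.+1 (tnth J k) i.
  by apply/entry_eq_row/arp_W_row_fixed; rewrite ltn_ord leqnn.
have detW : \det (rowsub (tnth J) (arp_W V H J r)) =
    \prod_(k < r) arp_W V H J k.+1 (tnth J k) k.
  rewrite det_trig.
    by apply: eq_bigr => k _; rewrite mxE Wrow.
  apply/is_trig_mxP => k i ki; rewrite mxE Wrow.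
  exact: (proj2 (HV J k)).
have -> : volume_prob V J =
    `|\det (rowsub (tnth J) (arp_W V H J r))| ^+ 2 / r`!%:R.
  rewrite /volume_prob WQ -mul_rowsub_mx det_mulmx normrM exprMn.
  rewrite [`|\det Q| ^+ 2]normCK.
  have := congr1 determinant Q1; rewrite det_mulmx det_map_mx det_tr det1 => ->.
  by rewrite mulr1.
(* The factorial is the product of the [r - k], which matches the normalization of each conditional
   probability. *)
rewrite detW normr_prod -prodrXl -ffactnn ffact_prod natr_prod.
rewrite -prodfV -big_split.
rewrite /arp_law rmorph_prod; apply: eq_bigr => k _ /=.
rewrite /arp_prob fmorph_div rmorph_nat; congr (_ / _).
have [hQ W0] := HV J k.
rewrite rmorph_sum /=; under eq_bigr => i _ do rewrite cmod_sqrC.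
(* Reflector [k] keeps the norm of the tail of the selected row and concentrates it in column
   [k]. *)
rewrite -(householder_tail_norm _ _ hQ) (bigD1 k) //= big1 ?addr0 //.
move=> i /andP[ki ik].
by rewrite [X in `|X|]W0 ?normr0 ?expr0n // ltn_neqAle eq_sym ik.
Qed.

End ARPLaw.

(** * Orthogonal projections and row sampling *)

Section Projection.
Variable C : numClosedFieldType.

Lemma sqnorm_mull m n p (Q : 'M[C]_(p, m)) (A : 'M[C]_(m, n)) :
  Q^t* *m Q = 1%:M -> sqnorm (Q *m A) = sqnorm A.
Proof. by move=> Q1; rewrite -sqnorm_trC trCmx_mul sqnorm_mulr ?sqnorm_trC. Qed.

Lemma sqnorm_proj_min m n r (Q : 'M[C]_(m, r)) (X Y : 'M[C]_(m, n)) :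
  Q^t* *m Q = 1%:M -> Q *m Q^t* *m Y = Y ->
  sqnorm (X - Q *m Q^t* *m X) <= sqnorm (X - Y).
Proof.
move=> Q1 QY.
have -> : X - Y = (X - Q *m Q^t* *m X) + Q *m (Q^t* *m (X - Y)).
  by rewrite mulmxA mulmxBr QY addrA subrK.
(* The two summands have mutually orthogonal columns, while [sqnormD] concerns rows: hence the
   conjugate transposes. *)
rewrite -[leRHS]sqnorm_trC linearD map_mxD /= [leRHS]sqnormD ?sqnorm_trC.
  by rewrite lerDl sqnorm_ge0.
have EQ : (X - Q *m Q^t* *m X)^t* *m Q = 0.
  rewrite linearB map_mxB /= !trCmx_mul trmxCK mulmxBl -!mulmxA Q1 mulmx1.
  by rewrite subrr.
by rewrite trmxCK mulmxA EQ mul0mx.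
Qed.

Lemma trC_invmx n (A : 'M[C]_n) : (invmx A)^t* = invmx (A^t*).
Proof. by rewrite trmx_inv map_invmx. Qed.

(** The conjugate transpose of the column bound, applied to [X^t*]. *)
Lemma volume_sampling_rows m n r (Q : 'M[C]_(m, r)) (X : 'M[C]_(m, n)) :
  Q^t* *m Q = 1%:M ->
  \sum_I volume_prob Q I *
     sqnorm (X - Q *m invmx (rowsub (tnth I) Q) *m rowsub (tnth I) X) <=
  r.+1%:R * sqnorm (X - Q *m Q^t* *m X).
Proof.
move=> Q1; have := volume_sampling_cols Q1 (X^t*).
have -> : X^t* - X^t* *m Q *m Q^t* = (X - Q *m Q^t* *m X)^t*.
  by rewrite linearB map_mxB /= !trCmx_mul trmxCK mulmxA.
rewrite sqnorm_trC.
rewrite (eq_bigr (fun I => volume_prob Q I *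
  sqnorm (X - Q *m invmx (rowsub (tnth I) Q) *m rowsub (tnth I) X))) //.
move=> I _; rewrite -[in RHS]sqnorm_trC linearB map_mxB /= !trCmx_mul.
by rewrite trC_invmx trC_rowsub mulmxA.
Qed.

End Projection.

(** * Finite probability: null outcomes and marginals *)

Lemma eq_mull_neq0 (K : pzRingType) (x a b : K) :
  (x != 0 -> a = b) -> x * a = x * b.
Proof. by have [->|_ ->//] := eqVneq x 0; rewrite !mul0r. Qed.

Section FiniteLaws.
Variable R : realType.

(** Absorbing [f] into factor [i] leaves a sum of products, which is a product of sums; the factors
    other than [i] are 1. *)
Lemma Expect_marginal (I S : finType) (p : I -> S -> R) (f : S -> R) (i : I) :
  (forall j, \sum_s p j s = 1) ->
  Expect (fun w : {ffun I -> S} => \prod_j p j (w j)) (fun w => f (w i)) =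
  Expect (p i) f.
Proof.
move=> p1; rewrite /Expect.
pose q j s := p j s * (if j == i then f s else 1).
transitivity (\sum_(w : {ffun I -> S}) \prod_j q j (w j)).
  apply: eq_bigr => w _; rewrite big_split /=; congr (_ * _).
  by rewrite (bigD1 i) //= eqxx big1 ?mulr1 // => j /negPf ->.
rewrite -bigA_distr_bigA (bigD1 i) //= [X in _ * X]big1 ?mulr1.
  by apply: eq_bigr => s _; rewrite /q eqxx.
move=> j /negPf ji; rewrite -(p1 j); apply: eq_bigr => s _.
by rewrite /q ji mulr1.
Qed.

(** On a finite space an almost sure event holds at every outcome of nonzero weight: the weights
    outside it are nonnegative with sum 0. *)
Lemma Pr1_supp (T : finType) (p : T -> R) (E : T -> bool) :
  (forall t, 0 <= p t) -> \sum_t p t = 1 -> Pr p E = 1 ->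
  forall t, p t != 0 -> E t.
Proof.
move=> p0 p1 pE t; apply: contraR => Et.
have : \sum_(s | ~~ E s) p s = 0.
  apply: (addrI (Pr p E)); rewrite addr0 {2}pE -p1 /Pr.
  by rewrite [RHS](bigID E).
by move/psumr_eq0P => ->.
Qed.

End FiniteLaws.

(** * Mean square error of matrix ARP-cross *)

Section Cross.
Variables (R : realType) (n1 n2 r : nat).
Local Notation C := R[i].

Lemma frob_sqr m n (A : 'M[C]_(m, n)) : (frob A ^+ 2)%:C%C = sqnorm A.
Proof.
rewrite /frob sqr_sqrtr; last first.
  by do 2![apply: sumr_ge0 => ? _]; rewrite sqr_ge0.
rewrite sqnormE rmorph_sum; apply: eq_bigr => i _ /=.
by rewrite rmorph_sum; apply: eq_bigr => j _ /=; rewrite cmod_sqrC.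
Qed.

Lemma arp_law_ge0 n (V : 'M[C]_(n, r)) H J : arp_reflectors V H ->
  0 <= arp_law V H J.
Proof.
move=> HV; rewrite -ler0c arp_lawE // /volume_prob.
by rewrite divr_ge0 ?exprn_ge0 ?ler0n.
Qed.

Lemma sum_arp_law n (V : 'M[C]_(n, r)) H : orthonormal_cols V ->
  arp_reflectors V H -> \sum_J arp_law V H J = 1.
Proof.
move=> V1 HV; apply: complexI; rewrite rmorph_sum rmorph1 -(sum_volume_prob V1).
by apply: eq_bigr => J _ /=; rewrite arp_lawE.
Qed.

Variables (X : 'M[C]_(n1, n2)) (V : 'M[C]_(n2, r)).
Variable c : cross_choices R n1 n2 r.
Hypotheses (V1 : orthonormal_cols V) (Xc : valid_choices X V c).

Lemma cross_law_ge0 w : 0 <= cross_law V c w.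
Proof.
have [HV /(_ w.2)[_ HQ]] := Xc.
by rewrite /cross_law mulr_ge0 ?arp_law_ge0.
Qed.

Lemma sum_cross_law : \sum_w cross_law V c w = 1.
Proof.
have [HV HQ] := Xc.
rewrite -(pair_bigA _ (fun I J => cross_law V c (I, J))) /= exchange_big /=.
rewrite -(sum_arp_law V1 HV); apply: eq_bigr => J _.
have [[Q1 _] HJ] := HQ J.
by rewrite /cross_law /= -mulr_sumr sum_arp_law // mulr1.
Qed.

(** With [X_J = Q T] the intersection is [Q_I T]. Its invertibility forces that of both square
    factors, and [T] cancels. *)
Lemma curE (w : cross_outcome n1 n2 r) (Q : 'M[C]_(n1, r)) :
  is_qr (colsub (tnth w.2) X) Q -> intersection X w \in unitmx ->
  cur X w = Q *m invmx (rowsub (tnth w.1) Q) *m rowsub (tnth w.1) X.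
Proof.
case=> Q1 [T [_ XQT]]; have XI : intersection X w = rowsub (tnth w.1) Q *m T.
  by rewrite mul_rowsub_mx -XQT; apply/matrixP => i j; rewrite !mxE.
rewrite /cur XI XQT => uQT; congr (_ *m _).
have /andP[uQ uT] : (rowsub (tnth w.1) Q \in unitmx) && (T \in unitmx).
  by rewrite -unitmx_mul.
by rewrite -{1}[Q](mulmxKV uQ) -(mulmxA _ _ T) mulmxK.
Qed.

Lemma cross_mse_le :
  (forall w, cross_law V c w != 0 -> intersection X w \in unitmx) ->
  Expect (cross_law V c) (fun w => frob (X - cur X w) ^+ 2) <=
  r.+1%:R ^+ 2 * frob (X - X *m V *m V^t*) ^+ 2.
Proof.
move=> Xu; have [HV HQ] := Xc.
rewrite -lecR rmorphM rmorphXn rmorph_nat /= frob_sqr /Expect rmorph_sum.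
rewrite expr2 -mulrA.
(* One factor [r + 1] comes from the column sampling; the other must come from the rows,
   conditionally on [J]. *)
apply: le_trans (ler_wpM2l (ler0n _ _) (volume_sampling_cols V1 X)).
rewrite mulr_sumr.
pose F I J := volume_prob V J * (volume_prob (qr_basis c J) I *
  sqnorm (X - qr_basis c J *m
  invmx (rowsub (tnth I) (qr_basis c J)) *m rowsub (tnth I) X)).
rewrite (eq_bigr (fun w => F w.1 w.2)); last first.
  move=> [I J] _ /=; have [qrJ HJ] := HQ J.
  rewrite rmorphM /= frob_sqr /F mulrA.
  have lE : (cross_law V c (I, J))%:C%C =
      volume_prob V J * volume_prob (qr_basis c J) I.
    by rewrite rmorphM /= !arp_lawE.
  (* The formula for [cur] is needed only at outcomes of nonzero probability, where the intersection
     is invertible. *)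
  rewrite lE; apply: eq_mull_neq0 => w0.
  rewrite (curE (w := (I, J)) qrJ) // Xu //.
  by apply: contra_neq w0 => w0; rewrite -[LHS]lE w0.
rewrite -(pair_bigA _ F) /= exchange_big /=; apply: ler_sum => J _.
have [[Q1 [T [_ QT]]] HJ] := HQ J.
rewrite -mulr_sumr mulrCA ler_wpM2l //.
  by rewrite divr_ge0 ?exprn_ge0 ?ler0n.
apply: le_trans (volume_sampling_rows X Q1) _; rewrite ler_wpM2l ?ler0n //.
(* The oblique projection has its columns in the range of [X_J], hence in that of [Q_J]. *)
apply: sqnorm_proj_min => //; rewrite /oblique_proj QT !mulmxA.
by rewrite -(mulmxA (qr_basis c J) _ (qr_basis c J)) Q1 mulmx1.
Qed.

End Cross.

(** * Roots of unity, Parseval's identity and conjugate symmetry *)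

Section Fourier.
Variable R : realType.
Local Notation C := R[i].

Lemma cisD (s t : R) : cis (s + t) = cis s * cis t.
Proof. by rewrite /cis cosD sinD; simpc; rewrite (addrC (sin s * _)). Qed.

Lemma cis0 : cis (0 : R) = 1.
Proof. by rewrite /cis cos0 sin0. Qed.

Lemma cisN (t : R) : cis (- t) = (cis t)^*.
Proof. by rewrite /cis cosN sinN. Qed.

Lemma cisMn (t : R) m : cis (m%:R * t) = cis t ^+ m.
Proof.
elim: m => [|m IHm]; first by rewrite mul0r cis0 expr0.
by rewrite -natr1 mulrDl mul1r cisD IHm exprSr.
Qed.

Lemma cis_conjM (t : R) : cis t * (cis t)^* = 1.
Proof. by rewrite -cisN -cisD subrr cis0. Qed.

Lemma cis_eq1 (t : R) : 0 <= t < 2 * pi -> cis t = 1 -> t = 0.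
Proof.
case/andP=> t0 tpi /(congr1 (@complex.Re R)) /= cos1.
apply/eqP; rewrite eq_le t0 andbT leNgt; apply/negP => {}t0.
(* Half-angle argument: [cos t = 1] forces [sin (t / 2) = 0], although [t / 2] lies strictly between
   0 and [pi]. *)
have : 0 < sin (t / 2).
  by apply: sin_gt0_pi; rewrite divr_gt0 // ltr_pdivrMr // mulrC.
have : sin (t / 2) ^+ 2 = 0.
  have := cos_mulr2n (t / 2).
  rewrite -[t / 2 *+ 2]mulr_natr divfK ?pnatr_eq0 //.
  rewrite cos1.
  by rewrite cos2sin2; lra.
by move/eqP; rewrite sqrf_eq0 => /eqP ->; rewrite ltxx.
Qed.

Variable n : nat.
Let zeta : C := cis (2 * pi / n%:R).

Lemma cis_zeta m : cis (2 * pi * m%:R / n%:R) = zeta ^+ m.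
Proof. by rewrite -cisMn mulrAC mulrC. Qed.

Lemma zeta_conj m : zeta ^+ m * (zeta ^+ m)^* = 1.
Proof. by rewrite -cis_zeta cis_conjM. Qed.

Lemma zeta_prim : (0 < n)%N -> n.-primitive_root zeta.
Proof.
move=> n0; have nR : n%:R != 0 :> R by rewrite pnatr_eq0 -lt0n.
rewrite /primitive_root_of_unity n0; apply/forallP => i; apply/eqP.
rewrite unity_rootE -cis_zeta; have [in1|in1] := eqVneq i.+1 n.
  rewrite in1 mulfK //; apply/eqP.
  by rewrite /cis mulrC mulr_natr cos2pi sin2pi.
apply/negbTE/negP => /eqP /cis_eq1.
rewrite !divr_ge0 ?mulr_ge0 ?pi_ge0 ?ler0n //=.
rewrite ltr_pdivrMr ?ltr0n // ltr_pM2l ?mulr_gt0 ?pi_gt0 //.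
rewrite ltr_nat ltn_neqAle in1 ltn_ord => /(_ isT) /eqP.
by rewrite gt_eqF // divr_gt0 ?mulr_gt0 ?pi_gt0 ?ltr0n.
Qed.

(** A geometric sum with ratio [z] satisfying [z ^+ n = 1]; as [zeta] is primitive, [z = 1] only for
    [a = b]. *)
Lemma zeta_orthogonal (a b : 'I_n) :
  \sum_(j < n) zeta ^+ (a * j) * (zeta ^+ (b * j))^* = (a == b)%:R * n%:R.
Proof.
have zp := zeta_prim (leq_ltn_trans (leq0n _) (ltn_ord a)).
pose z := zeta ^+ a * (zeta ^+ b)^*.
under eq_bigr => j _ do rewrite !exprM rmorphXn -exprMn -/z.
have [ab|ab] := eqVneq a b.
  under eq_bigr => j _ do rewrite /z ab zeta_conj expr1n.
  by rewrite sumr_const card_ord mul1r.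
have zn : z ^+ n = 1.
  rewrite exprMn -rmorphXn /= ![_ ^+ _ ^+ n]exprAC (prim_expr_order zp).
  by rewrite !expr1n rmorph1 mulr1.
rewrite mul0r; apply/eqP; have := subrX1 z n; rewrite zn subrr.
move/esym/eqP; rewrite mulf_eq0 => /orP[|//]; rewrite subr_eq0 => /eqP z1.
case/eqP: ab; apply: val_inj => /=; apply/eqP.
rewrite -[val a](modn_small (ltn_ord a)) -[val b](modn_small (ltn_ord b)).
rewrite -(eq_prim_root_expr zp); apply/eqP.
by rewrite -[LHS]mulr1 -(zeta_conj b) mulrCA -/z z1 mulr1.
Qed.

Lemma dftE n1 n2 (A : tensor C n1 n2 n) l i j :
  dft A l i j = \sum_(k < n) (zeta ^+ (l * k))^* * A k i j.
Proof.
rewrite summxE; apply: eq_bigr => k _; rewrite mxE; congr (_ * _).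
by rewrite cisN cis_zeta.
Qed.

Lemma ifftE n1 n2 (A : tensor C n1 n2 n) k i j :
  ifft A k i j = n%:R^-1 * \sum_(l < n) zeta ^+ (l * k) * A l i j.
Proof.
rewrite mxE summxE; congr (_ * _); apply: eq_bigr => l _; rewrite mxE.
by rewrite cis_zeta.
Qed.

Lemma dftB n1 n2 (A B : tensor C n1 n2 n) l :
  dft (fun k => A k - B k) l = dft A l - dft B l.
Proof. by rewrite -sumrB; apply: eq_bigr => k _; rewrite scalerBr. Qed.

Lemma dft_ifft n1 n2 (A : tensor C n1 n2 n) l : dft (ifft A) l = A l.
Proof.
have n0 : n%:R != 0 :> C.
  by rewrite pnatr_eq0 -lt0n (leq_ltn_trans _ (ltn_ord l)).
apply/matrixP => i j; rewrite dftE.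
under eq_bigr => k _ do rewrite ifftE mulrCA mulr_sumr.
rewrite -mulr_sumr exchange_big /=.
transitivity (n%:R^-1 * \sum_(m < n) ((m == l)%:R * n%:R) * A m i j).
  congr (_ * _); apply: eq_bigr => m _; rewrite -zeta_orthogonal mulr_suml.
  by apply: eq_bigr => k _; rewrite mulrCA mulrA.
rewrite (bigD1 l) //= big1 ?addr0 => [|m /negPf ->]; last by rewrite !mul0r.
by rewrite eqxx mul1r mulrA mulVf // mul1r.
Qed.

Lemma sum_sqr_norm_dft (a : 'I_n -> C) :
  \sum_(l < n) `|\sum_(k < n) (zeta ^+ (l * k))^* * a k| ^+ 2 =
  n%:R * \sum_(k < n) `|a k| ^+ 2.
Proof.
transitivity (\sum_(k < n) \sum_(m < n)
    a k * (a m)^* * \sum_(l < n) zeta ^+ (m * l) * (zeta ^+ (k * l))^*).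
  under eq_bigr => l _.
    rewrite normCK rmorph_sum mulr_suml.
    under eq_bigr => k _ do rewrite mulr_sumr.
    over.
  rewrite exchange_big; apply: eq_bigr => k _ /=.
  rewrite exchange_big; apply: eq_bigr => m _ /=.
  rewrite mulr_sumr; apply: eq_bigr => l _.
  rewrite [X in _ * X]rmorphM /= conjCK ![(l * _)%N]mulnC.
  by rewrite mulrACA mulrC [X in _ * X]mulrC.
rewrite mulr_sumr; apply: eq_bigr => k _.
rewrite (bigD1 k) //= [X in _ + X]big1 ?addr0 => [|m /negPf mk].
  by rewrite zeta_orthogonal eqxx mul1r normCK mulrC.
by rewrite zeta_orthogonal mk mul0r mulr0.
Qed.

Lemma Parseval n1 n2 (A : tensor C n1 n2 n) :
  \sum_k frob (A k) ^+ 2 = n%:R^-1 * \sum_l frob (dft A l) ^+ 2.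
Proof.
(* For [n = 0] both sums are empty, whatever the value of the inverse of 0. *)
have [n0|n0] := posnP n.
  by rewrite !big1 ?mulr0 // => k; have := ltn_ord k; rewrite {2}n0.
apply: (@mulfI _ n%:R); first by rewrite pnatr_eq0 -lt0n.
rewrite mulrA divff ?pnatr_eq0 -?lt0n // mul1r.
apply: complexI; rewrite rmorphM rmorph_nat !rmorph_sum /=.
under eq_bigr => k _ do rewrite frob_sqr sqnormE.
under [RHS]eq_bigr => k _ do rewrite frob_sqr sqnormE.
rewrite exchange_big [RHS]exchange_big /= mulr_sumr; apply: eq_bigr => i _.
rewrite exchange_big [RHS]exchange_big /= mulr_sumr; apply: eq_bigr => j _.
by under [RHS]eq_bigr => l _ do rewrite dftE; rewrite sum_sqr_norm_dft.
Qed.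

(** Negating the frequency modulo [n] conjugates the powers of [zeta], and [X] is real. The
    reduction modulo [n] covers [l = 0]. *)
Lemma fhat_conj_freq n1 n2 (X : tensor R n1 n2 n) (l : 'I_n) :
  fhat X (conj_freq l) = (fhat X l) ^ Num.conj.
Proof.
have n0 := leq_ltn_trans (leq0n _) (ltn_ord l).
have zetal : zeta ^+ conj_freq l = (zeta ^+ l)^*.
  rewrite /= (prim_expr_mod (zeta_prim n0)) -[LHS]mulr1 -(zeta_conj l) mulrA.
  rewrite -exprD subnK ?(ltnW (ltn_ord l)) //.
  by rewrite (prim_expr_order (zeta_prim n0)) mul1r.
apply/matrixP => i j; rewrite [in RHS]mxE !dftE rmorph_sum.
apply: eq_bigr => k _; rewrite rmorphM; congr (_ * _); last first.
  by rewrite !mxE; apply: esym; exact: conjc_real.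
by rewrite !exprM zetal -rmorphXn.
Qed.

End Fourier.

(** * Ky Fan's inequality and truncated singular value decompositions *)

Section EckartYoung.
Variable R : realType.
Local Notation C := R[i].

(* Bathtub principle: the threshold [t r] separates the [r] largest values
   from the others. *)
Lemma bathtub n r (K : numDomainType) (t : nat -> K) (p : 'I_n -> K) :
  (r <= n)%N -> (forall i, 0 <= t i) ->
  (forall i j, (i <= j)%N -> t j <= t i) ->
  (forall a, 0 <= p a <= 1) -> \sum_a p a = r%:R ->
  \sum_(a < n) t a * p a <= \sum_(a < n | (a < r)%N) t a.
Proof.
move=> rn t0 tmono p01 sump.
have -> : \sum_(a < n | (a < r)%N) t a =
    \sum_(a < n | (a < r)%N) (t a - t r) + t r * r%:R.
  rewrite sumrB sumr_const (_ : #|_| = r) ?mulr_natr ?subrK //.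
  by rewrite -sum1_card big_ord_narrow // sum1_card card_ord.
rewrite -sump mulr_sumr -lerBlDr -sumrB [leRHS]big_mkcond.
apply: ler_sum => a _; rewrite -mulrBl.
have /andP[p0 p1] := p01 a; case: ltnP => ar.
  by rewrite ler_piMr // subr_ge0 tmono // ltnW.
by rewrite mulr_le0_ge0 // subr_le0 tmono.
Qed.

(** Squared singular values, set to 0 from index [m] on: [is_svd] leaves [s] free there, and sums
    can run over all [n] columns. *)
Definition sqr_sv m (s : nat -> R) (a : nat) : C :=
  if (a < m)%N then (s a)%:C%C ^+ 2 else 0.

Lemma gram_diag_sv m n (s : nat -> R) :
  (diag_sv m n s)^t* *m diag_sv m n s = diag_mx (\row_a sqr_sv m s a).
Proof.
apply/matrixP => a b; rewrite !mxE /sqr_sv.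
have [am|ma] := ltnP a m; last first.
  rewrite mul0rn big1 // => i _; rewrite !mxE.
  by rewrite (ltn_eqF (leq_trans (ltn_ord i) ma)) conjC0 mul0r.
rewrite (bigD1 (Ordinal am)) //= big1 ?addr0 => [|i ia].
  rewrite !mxE /= eqxx -val_eqE /=.
  case: (a == b :> nat); last by rewrite mulr0.
  by rewrite expr2; congr (_ * _); exact: conjc_real.
rewrite !mxE; case: eqP => [ia'|_]; last by rewrite conjC0 mul0r.
by move: ia; rewrite -val_eqE /= ia' eqxx.
Qed.

Lemma sqnorm_diag_sv_mul m n q (s : nat -> R) (Y : 'M[C]_(n, q)) :
  sqnorm (diag_sv m n s *m Y) =
  \sum_(a < n) sqr_sv m s a * \sum_(i < q) `|Y a i| ^+ 2.
Proof.
rewrite /sqnorm trCmx_mul mulmxA mxtrace_mulC !mulmxA gram_diag_sv.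
rewrite -mulmxA; apply: eq_bigr => a _; rewrite mul_diag_mx !mxE.
by congr (_ * _); apply: eq_bigr => i _; rewrite !mxE normCK.
Qed.

Lemma sqnorm_colsub_diag_sv m n q (f : 'I_q -> 'I_n) (s : nat -> R) :
  sqnorm (colsub f (diag_sv m n s)) = \sum_i sqr_sv m s (f i).
Proof.
rewrite /sqnorm mxtrace_mulC.
have -> : (colsub f (diag_sv m n s))^t* *m colsub f (diag_sv m n s) =
    mxsub f f ((diag_sv m n s)^t* *m diag_sv m n s).
  by apply/matrixP => i j; rewrite !mxE; apply: eq_bigr => k _; rewrite !mxE.
by rewrite gram_diag_sv; apply: eq_bigr => i _; rewrite !mxE eqxx.
Qed.

Lemma sqnorm_diag_sv m n (s : nat -> R) :
  sqnorm (diag_sv m n s) = \sum_(a < n) sqr_sv m s a.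
Proof.
rewrite -(sqnorm_colsub_diag_sv m id); congr sqnorm.
by apply/matrixP => i j; rewrite [RHS]mxE.
Qed.

Lemma sqnorm_proj_compl m n r (A : 'M[C]_(m, n)) (V : 'M[C]_(n, r)) :
  V^t* *m V = 1%:M ->
  sqnorm (A - A *m V *m V^t*) = sqnorm A - sqnorm (A *m V).
Proof.
move=> V1; have EV : (A - A *m V *m V^t*) *m V = 0.
  by rewrite mulmxBl -!mulmxA V1 mulmx1 subrr.
have := @sqnormD _ _ _ (A - A *m V *m V^t*) (A *m V *m V^t*).
rewrite subrK trCmx_mul trmxCK mulmxA EV mul0mx => -> //.
by rewrite (sqnorm_mulr _ V1) addrK.
Qed.

Lemma sqnorm_leading m n r (rn : (r <= n)%N) (A : 'M[C]_(m, n)) U s W :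
  is_svd A U s W ->
  sqnorm (A *m colsub (widen_ord rn) W) = \sum_(a < n | (a < r)%N) sqr_sv m s a.
Proof.
case=> [/unitarymxP/mulmx1C U1 /unitarymxP/mulmx1C W1 _ _ ->].
rewrite mulmx_colsub -2!mulmxA W1 mulmx1.
rewrite -mulmx_colsub sqnorm_mull // sqnorm_colsub_diag_sv.
by rewrite big_ord_narrow.
Qed.

Lemma sqnorm_svd m n (A : 'M[C]_(m, n)) U s W : is_svd A U s W ->
  sqnorm A = \sum_(a < n) sqr_sv m s a.
Proof.
case=> [/unitarymxP/mulmx1C U1 /unitarymxP/mulmx1C W1 _ _ ->].
by rewrite sqnorm_mulr // sqnorm_mull // sqnorm_diag_sv.
Qed.

(** With [Q = W^H P], the left side weights each squared singular value by the squared norm of the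
    first [r] entries of a row of [Q]. These weights lie in [0, 1] and sum to [r], so the bathtub
    principle applies. *)
Lemma Ky_Fan m n r (rn : (r <= n)%N) (A : 'M[C]_(m, n)) U s W (P : 'M[C]_n) :
  is_svd A U s W -> P \is unitarymx ->
  sqnorm (A *m colsub (widen_ord rn) P) <=
  \sum_(a < n | (a < r)%N) sqr_sv m s a.
Proof.
case=> [/unitarymxP/mulmx1C U1 Wu s0 smono ->] Pu.
pose Q := W^t* *m P.
have Qu : Q \is unitarymx.
  by apply: (mul_unitarymx _ Pu); rewrite trmxC_unitary.
rewrite -2!mulmxA sqnorm_mull // mulmx_colsub -/Q sqnorm_diag_sv_mul.
have Q1 : Q^t* *m Q = 1%:M by apply: mulmx1C; apply/unitarymxP.
have sv0 i : 0 <= sqr_sv m s i.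
  by rewrite /sqr_sv; case: ifP => // _; rewrite exprn_ge0 // ler0c.
apply: bathtub => //.
- move=> i j ij; rewrite /sqr_sv; case: ltnP => [jm|_]; last exact: sv0.
  by rewrite (leq_ltn_trans ij jm) lerXn2r ?nnegrE ?ler0c // lecR smono.
- move=> a; apply/andP; split.
    by apply: sumr_ge0 => i _; rewrite exprn_ge0.
  have /unitarymxP/matrixP/(_ a a) := Qu.
  rewrite [LHS]mxE [RHS]mxE eqxx mulr1n => <-.
  rewrite [leRHS](eq_bigr (fun i => `|Q a i| ^+ 2)); last first.
    by move=> i _; rewrite !mxE normCK.
  rewrite [leRHS](bigID (fun i : 'I_n => (i < r)%N)) /= big_ord_narrow.
  under eq_bigr => i _ do rewrite mxE.
  by rewrite lerDl sumr_ge0 // => i _; rewrite exprn_ge0.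
- rewrite exchange_big /=.
  transitivity (\sum_(i < r) (1 : C)); last by rewrite sumr_const card_ord.
  apply: eq_bigr => i _.
  have /matrixP/(_ (widen_ord rn i) (widen_ord rn i)) := Q1.
  rewrite [LHS]mxE [RHS]mxE eqxx mulr1n => <-; apply: eq_bigr => a _.
  by rewrite !mxE mulrC normCK.
Qed.

Lemma truncated_svd_dist m n r (A B : 'M[C]_(m, n)) U s W :
  is_svd A U s W ->
  B = U *m diag_sv m n (fun i => if (i < r)%N then s i else 0) *m W^t* ->
  sqnorm (A - B) = sqnorm A - \sum_(a < n | (a < r)%N) sqr_sv m s a.
Proof.
move=> svdA ->; rewrite (sqnorm_svd svdA).
case: svdA => [/unitarymxP/mulmx1C U1 /unitarymxP/mulmx1C W1 _ _ ->].
rewrite -mulmxBl -mulmxBr sqnorm_mulr // sqnorm_mull //.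
have -> : diag_sv m n s - diag_sv m n (fun i => if (i < r)%N then s i else 0) =
    diag_sv m n (fun i => if (i < r)%N then 0 else s i).
  apply/matrixP => i j; rewrite !mxE -rmorphB.
  apply: (congr1 (real_complex R)).
  by case: (_ == _); case: (_ < _)%N; rewrite ?subr0 ?subrr.
rewrite sqnorm_diag_sv.
rewrite [X in _ = X - _](bigID (fun a : 'I_n => (a < r)%N)) /=.
rewrite addrAC subrr add0r.
rewrite (bigID (fun a : 'I_n => (a < r)%N)) /= big1 ?add0r => [|a ar].
  by apply: eq_bigr => a /negPf ar; rewrite /sqr_sv ar.
by rewrite /sqr_sv ar rmorph0 expr0n if_same.
Qed.

Lemma leading_rsv_optimal m n r (A B : 'M[C]_(m, n)) (V : 'M[C]_(n, r)) :
  (r <= n)%N -> orthonormal_cols V -> contains_leading_rsv A V ->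
  is_truncated_svd r A B ->
  sqnorm (A - A *m V *m V^t*) <= sqnorm (A - B).
Proof.
move=> rn V1 [U [s [W [svdA AV]]]] [U' [s' [W' [svdA' BE]]]].
rewrite sqnorm_proj_compl // (truncated_svd_dist svdA' BE) lerD2l lerN2.
rewrite -(sqnorm_leading rn svdA').
have W'u : W' \is unitarymx by case: svdA'.
(* The two decompositions of [A] may differ; Ky Fan's inequality for the first, tested on the
   singular vectors of the second, compares them. *)
apply: le_trans (Ky_Fan rn svdA W'u) _; rewrite -(sqnorm_leading rn svdA).
have /fin_all_exists[f fE] :
    forall i : 'I_r, exists j, col j V = col (widen_ord rn i) W.
  by move=> i; apply: AV => /=.
(* Distinct columns of the unitary [W] differ, so the positions in [V] are distinct and [f] permutes
   the columns of [V]. *)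
have finj : injective f.
  move=> i j fij; apply/eqP; apply/negPn/negP => ij.
  have : col (widen_ord rn i) W = col (widen_ord rn j) W by rewrite -!fE fij.
  have /unitarymxP/mulmx1C : W \is unitarymx by case: svdA.
  move/matrixP => W1 /colP Wij.
  have := W1 (widen_ord rn i) (widen_ord rn j).
  have := W1 (widen_ord rn i) (widen_ord rn i).
  rewrite !mxE eqxx -val_eqE /= val_eqE (negPf ij) => W11 W10.
  have /eqP : (1 : C) = 0.
    rewrite -[RHS]W10 -[LHS]W11; apply: eq_bigr => k _.
    by have := Wij k; rewrite !mxE => ->.
  by rewrite oner_eq0.
have -> : colsub (widen_ord rn) W = colsub f V.
  apply/matrixP => k i; rewrite !mxE.
  by have /colP/(_ k) := fE i; rewrite !mxE.
rewrite -sqnorm_trC -[leRHS]sqnorm_trC !sqnormE [leRHS](reindex_inj finj) /=.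
by apply: ler_sum => i _; apply: ler_sum => j _; rewrite mulmx_colsub !mxE.
Qed.

End EckartYoung.

(** * From Fourier slices to tensors *)

Section TCUR.
Variable R : realType.
Local Notation C := R[i].

Lemma ler_cmod_real_Re (x : R) (z : C) :
  cmod ((x - complex.Re z)%:C%C) <= cmod (x%:C%C - z).
Proof.
rewrite -lecR !cmodC !normc_def lecR ler_sqrt.
  by case: z => a b /=; rewrite expr0n addr0 lerDl sqr_ge0.
by rewrite addr_ge0 ?sqr_ge0.
Qed.

Lemma frob_real_Re_le m n (X : 'M[R]_(m, n)) (Z : 'M[C]_(m, n)) :
  frob (cplx_mx (X - map_mx (@complex.Re R) Z)) ^+ 2 <=
  frob (cplx_mx X - Z) ^+ 2.
Proof.
rewrite lerXn2r ?nnegrE ?sqrtr_ge0 // ler_sqrt; last first.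
  by do 2![apply: sumr_ge0 => ? _]; rewrite sqr_ge0.
do 2![apply: ler_sum => ? _]; rewrite !mxE.
by rewrite lerXn2r ?nnegrE ?ler_cmod_real_Re // -ler0c cmodC.
Qed.

Lemma frob_conj m n (A : 'M[C]_(m, n)) : frob (A ^ Num.conj)%sesqui = frob A.
Proof.
congr Num.sqrt; apply: eq_bigr => i _; apply: eq_bigr => j _; rewrite mxE.
by rewrite /cmod norm_conjC.
Qed.

Lemma tfrob_sqr n1 n2 n3 (A : tensor C n1 n2 n3) :
  tfrob A ^+ 2 = \sum_k frob (A k) ^+ 2.
Proof. by rewrite sqr_sqrtr // sumr_ge0 // => k _; rewrite sqr_ge0. Qed.

(** Since [X] is real, discarding the imaginary part cannot increase the error; Parseval's identity
    does the rest. *)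
Lemma tcur_error_le n1 n2 n3 r (X : tensor R n1 n2 n3)
    (w : tcur_outcome n1 n2 n3 r) :
  tfrob (fun k => cplx_mx (X k - tcur X w k)) ^+ 2 <=
  n3%:R^-1 * \sum_l frob (fhat X l - tcur_hat X w l) ^+ 2.
Proof.
have -> : \sum_l frob (fhat X l - tcur_hat X w l) ^+ 2 =
    \sum_l frob (dft (fun k => cplx_mx (X k) - ifft (tcur_hat X w) k) l) ^+ 2.
  by apply: eq_bigr => l _; rewrite dftB dft_ifft.
rewrite tfrob_sqr -Parseval; apply: ler_sum => k _; exact: frob_real_Re_le.
Qed.

Section Expectation.
Variables (n1 n2 n3 r : nat) (X : tensor R n1 n2 n3).
Variable V : 'I_n3 -> 'M[C]_(n2, r).
Variable c : nonred n3 -> cross_choices R n1 n2 r.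
Hypothesis V1 : forall l, orthonormal_cols (V l).
Hypothesis Vconj :
  forall l : 'I_n3, (0 < l)%N -> V (conj_freq l) = (V l) ^ Num.conj.
Hypothesis Xc :
  forall l : nonred n3, valid_choices (fhat X (val l)) (V (val l)) (c l).
Hypothesis Xas : forall l : nonred n3,
  Pr (tcur_law V c) (fun w =>
    (\rank (colsub (tnth (w l).2) (fhat X (val l))) == r)
    && (intersection (fhat X (val l)) (w l) \in unitmx)) = 1.

Local Notation resid l := (fhat X l - fhat X l *m V l *m (V l)^t*).

(** The hypothesis concerns the joint law; its marginal at [l] is [cross_law], and on a finite space
    almost surely means on the whole support. *)
Lemma intersection_unit (l : nonred n3) w :
  cross_law (V (val l)) (c l) w != 0 ->
  intersection (fhat X (val l)) w \in unitmx.
Proof.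
pose E (w : cross_outcome n1 n2 r) :=
  (\rank (colsub (tnth w.2) (fhat X (val l))) == r) &&
  (intersection (fhat X (val l)) w \in unitmx).
suff PE : Pr (cross_law (V (val l)) (c l)) E = 1.
  have p0 t := cross_law_ge0 (Xc l) t.
  have p1 := sum_cross_law (V1 (val l)) (Xc l).
  by move/(Pr1_supp p0 p1 PE)/andP => [].
have PrE (T : finType) (p : T -> R) F : Pr p F = Expect p (fun t => (F t)%:R).
  rewrite /Pr big_mkcond; apply: eq_bigr => t _.
  by case: (F t); rewrite ?mulr1 ?mulr0.
rewrite PrE -(@Expect_marginal _ _ _ (fun m => cross_law (V (val m)) (c m))).
  by have := Xas l; rewrite PrE.
by move=> m; exact: sum_cross_law (V1 _) (Xc m).
Qed.

Lemma nonred_mse_le (l : nonred n3) :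
  Expect (tcur_law V c) (fun w =>
    frob (fhat X (val l) - cur (fhat X (val l)) (w l)) ^+ 2) <=
  r.+1%:R ^+ 2 * frob (resid (val l)) ^+ 2.
Proof.
rewrite (Expect_marginal (p := fun m => cross_law (V (val m)) (c m))
  (fun s => frob (fhat X (val l) - cur (fhat X (val l)) s) ^+ 2)).
  exact: cross_mse_le (V1 _) (Xc l) (@intersection_unit l).
by move=> m; exact: sum_cross_law (V1 _) (Xc m).
Qed.

Lemma slice_mse_le (l : 'I_n3) :
  Expect (tcur_law V c) (fun w => frob (fhat X l - tcur_hat X w l) ^+ 2) <=
  r.+1%:R ^+ 2 * frob (resid l) ^+ 2.
Proof.
have [ln|nl] := leqP l n3./2.
  have := nonred_mse_le (Sub l ln); rewrite SubK; congr (_ <= _).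
  by apply: eq_bigr => w _; rewrite /tcur_hat insubT.
(* Above [n3 / 2] the paired frequency is nonredundant. Slice, basis and approximation are all
   conjugated, which leaves every norm unchanged. *)
have l0 : (0 < l)%N by apply: leq_ltn_trans nl.
have n30 : (0 < n3)%N by apply: leq_ltn_trans (ltn_ord l).
have cl : (conj_freq l <= n3./2)%N.
  rewrite /= modn_small; last by rewrite ltn_subrL l0.
  rewrite leq_subLR -{1}(odd_double_half n3) -addnn addnA leq_add2r.
  by apply: leq_trans nl; rewrite -add1n leq_add2r; case: (odd n3).
have lK : conj_freq (conj_freq l) = l.
  apply: val_inj => /=; rewrite (modn_small (_ : n3 - l < n3)%N); last first.
    by rewrite ltn_subrL l0.
  by rewrite subKn ?modn_small // ltnW.
have m0 : (0 < conj_freq l)%N.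
  rewrite /= modn_small; last by rewrite ltn_subrL l0.
  by rewrite subn_gt0.
have fl : fhat X l = (fhat X (conj_freq l)) ^ Num.conj.
  by rewrite -fhat_conj_freq lK.
have vl : V l = (V (conj_freq l)) ^ Num.conj by rewrite -Vconj // lK.
have -> : frob (resid l) = frob (resid (conj_freq l)).
  by rewrite fl vl map_trmx -!map_mxM -map_mxB frob_conj.
have := nonred_mse_le (Sub (conj_freq l) cl); rewrite SubK; congr (_ <= _).
apply: eq_bigr => w _; congr (_ * _ ^+ 2); rewrite /tcur_hat insubF.
  by rewrite insubT SubK fl -map_mxB frob_conj.
by rewrite leqNgt nl.
Qed.

Lemma tcur_mse_le :
  tcur_mse X V c <=
  r.+1%:R ^+ 2 / n3%:R * \sum_(l < n3) frob (resid l) ^+ 2.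
Proof.
rewrite -mulrA mulrCA mulr_sumr.
apply: (@le_trans _ _ (n3%:R^-1 * \sum_l Expect (tcur_law V c)
    (fun w => frob (fhat X l - tcur_hat X w l) ^+ 2))).
  rewrite exchange_big mulr_sumr; apply: ler_sum => w _ /=.
  rewrite -mulr_sumr [leRHS]mulrCA ler_wpM2l ?tcur_error_le //.
  by apply: prodr_ge0 => l _; exact: cross_law_ge0 (Xc l) _.
by rewrite ler_wpM2l ?invr_ge0 ?ler0n // ler_sum // => l _; exact: slice_mse_le.
Qed.

End Expectation.

End TCUR.

Theorem theorem4p1 (R : realType) (n1 n2 n3 r : nat)
    (X : tensor R n1 n2 n3) (V : 'I_n3 -> 'M[R[i]]_(n2, r))
    (c : nonred n3 -> cross_choices R n1 n2 r) :
  (r <= minn n1 n2)%N ->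
  (forall l, orthonormal_cols (V l)) ->
  (forall l : 'I_n3, (0 < l)%N -> V (conj_freq l) = (V l) ^ Num.conj) ->
  (forall l : 'I_n3, l = 0%N :> nat -> V l \is a mxOver Num.real) ->
  (forall l : nonred n3, valid_choices (fhat X (val l)) (V (val l)) (c l)) ->
  (forall l : nonred n3,
     Pr (tcur_law V c) (fun w =>
       (\rank (colsub (tnth (w l).2) (fhat X (val l))) == r)
       && (intersection (fhat X (val l)) (w l) \in unitmx)) = 1) ->
  tcur_mse X V c <= r.+1%:R ^+ 2 / n3%:R *
           \sum_(l < n3) frob (fhat X l - fhat X l *m V l *m (V l)^t*) ^+ 2
  /\
  ((forall l, contains_leading_rsv (fhat X l) (V l)) ->
   forall Xr : tensor R[i] n1 n2 n3,
     is_truncated_tsvd r (fun k => cplx_mx (X k)) Xr ->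
     tcur_mse X V c <= r.+1%:R ^+ 2 * tfrob (fun k => cplx_mx (X k) - Xr k) ^+ 2).
Proof.
rewrite leq_min => /andP[_ rn2] V1 Vconj _ Xc Xas.
have mse := tcur_mse_le V1 Vconj Xc Xas; split=> // Xlead Xr XrE.
apply: le_trans mse _; rewrite -mulrA ler_wpM2l ?exprn_ge0 //.
(* Parseval's identity yields the same factor [1 / n3] on the right, so the comparison reduces to
   single Fourier slices. *)
rewrite tfrob_sqr Parseval ler_wpM2l ?invr_ge0 //; apply: ler_sum => l _.
rewrite dftB -lecR !frob_sqr.
exact: (leading_rsv_optimal rn2 (V1 l) (Xlead l) (XrE l)).
Qed.
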